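(* Let $p,C>0$, let $g$ be a function on $[1,\infty)$ with $g(t)\to1$ as $t\to\infty$, and let $F$ be an absolutely continuous distribution function such that for all $x\ge1$ $$1-F(x)=\exp\left(-\int_{1}^{x}\frac{g(t)\,dt}{Ct^{1-p}}\right).$$ Put $\alpha(t)=g(t)-1$, $b_n=F^{\leftarrow}(1-n^{-1})$, $a_n=f(b_n)=Cb_n^{1-p}$ with $f(t)=Ct^{1-p}$, and $$\gamma_n(x)=-\log\frac{1-F(b_n+a_nx)}{1-F(b_n)}.$$ Let $M_n$ be the maximum of $n$ i.i.d. random variables with distribution function $F$. Then for any $x\in\mathbb{R}$, as $n\to\infty$, $$P(M_n\le a_nx+b_n)-\exp\left(-e^{-x}\right)=\exp\left(-e^{-x}\right)e^{-x}(\gamma_n(x)-x)(1+o(1))+O(n^{-1}),$$ where $$\gamma_n(x)-x=(1+o(1))\left(\frac{(p-1)x^{2}}{2p\log n}+\int_{0}^{x}\alpha\left(b_n+Cb_n^{1-p}v\right)dv\right).$$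
   Context: $F^{\leftarrow}(y)=\inf\{x: F(x)\ge y\}$ is the generalized inverse. Distributions of this form are called generalized Weibull-like distributions.
   Formalization: In the second display the common factor 1+o(1) is false when the two terms cancel; it is applied to each term separately (two o(1) factors), and as a common factor only for those n where the sum of the absolute values of the two terms is at most K times the absolute value of their sum. *)

(* Defs.v *)
From HB Require Import structures.
From mathcomp Require Import all_boot all_order all_algebra.
From mathcomp Require Import all_classical all_reals all_analysis.

Set Implicit Arguments.
Unset Strict Implicit.
Unset Printing Implicit Defensive.

Import Order.TTheory GRing.Theory Num.Theory.
Import numFieldNormedType.Exports.

Local Open Scope classical_set_scope.
Local Open Scope ring_scope.

Definition mutually_independent d (T : measurableType d) (R : realType)
    (P : probability T R) (X : nat -> {RV P >-> R}) : Prop :=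
  forall (s : seq nat) (A : nat -> set R), uniq s ->
    (forall i, measurable (A i)) ->
    P (\bigcap_(i in [set` s]) (X i @^-1` A i)) =
    (\prod_(i <- s) P (X i @^-1` A i))%E.

Definition iid_with_df d (T : measurableType d) (R : realType)
    (P : probability T R) (X : nat -> {RV P >-> R}) (F : R -> R) : Prop :=
  mutually_independent X /\ (forall i y, cdf (X i) y = (F y)%:E).

(* The maximum of X 0, ..., X n.-1 for n >= 1; the default X 0 is among them. *)
Definition partial_max d (T : measurableType d) (R : realType)
    (P : probability T R) (X : nat -> {RV P >-> R}) (n : nat) (w : T) : R :=
  \big[Num.max/X 0%N w]_(i < n) X i w.

(* The integral from a to b with orientation: its sign changes when b < a. *)
Definition oriented_integral (R : realType) (a b : R) (h : R -> R) : R :=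
  if a <= b then \int[lebesgue_measure]_(v in `[a, b]) h v
  else - \int[lebesgue_measure]_(v in `[b, a]) h v.

(* inf is real-valued, hence 0 by convention on a set that is empty or
   unbounded below. For the sequence below this only concerns n <= 1. *)
Definition generalized_inverse (R : realType) (F : R -> R) (y : R) : R :=
  inf [set x | y <= F x].

Section weibull_like.
Context {R : realType}.
Variables (p C : R).

Definition aux_fun (t : R) : R := C * t `^ (1 - p).

Definition weibull_like_df (g F : R -> R) : Prop :=
  (forall x, 1 <= x ->
    lebesgue_measure.-integrable `[1, x] (EFin \o (fun t => g t / aux_fun t))) /\
  (forall x, 1 <= x ->
    1 - F x =
    expR (- \int[lebesgue_measure]_(t in `[1, x]) (g t / aux_fun t))).

Definition b_ (F : R -> R) (n : nat) : R :=
  generalized_inverse F (1 - n%:R^-1).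

Definition a_ (F : R -> R) (n : nat) : R := aux_fun (b_ F n).

Definition gamma (F : R -> R) (n : nat) (x : R) : R :=
  - ln ((1 - F (b_ F n + a_ F n * x)) / (1 - F (b_ F n))).

Definition quadratic_term (x : R) (n : nat) : R :=
  (p - 1) * x ^+ 2 / (2 * p * ln n%:R).

Definition alpha_term (g F : R -> R) (x : R) (n : nat) : R :=
  oriented_integral 0 x
    (fun v => g (b_ F n + C * b_ F n `^ (1 - p) * v) - 1).

(* The meaning of u_n = (1 + o(1)) (A_n + B_n): the factor 1 + o(1) is
   distributed over the sum, i.e. u_n = A_n + B_n + o(|A_n| + |B_n|). This allows
   the leading parts of A_n and B_n to cancel, in which case a relative error
   with respect to A_n + B_n itself is not available; the second clause gives
   the common factor on the indices n where A_n + B_n is comparable to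
   |A_n| + |B_n|. *)
Definition equiv_to_sum (u A B : R^nat) : Prop :=
  (exists e1 e2 : R^nat,
    [/\ e1 n @[n --> \oo] --> (0 : R), e2 n @[n --> \oo] --> (0 : R) &
        \forall n \near \oo, u n = (1 + e1 n) * A n + (1 + e2 n) * B n]) /\
  (forall K : R, exists e : R^nat,
    e n @[n --> \oo] --> (0 : R) /\
    \forall n \near \oo, `|A n| + `|B n| <= K * `|A n + B n| ->
      u n = (1 + e n) * (A n + B n)).

End weibull_like.

(* Main.v *)
Require Import Defs.
From HB Require Import structures.
From mathcomp Require Import all_boot all_order all_algebra.
From mathcomp Require Import all_classical all_reals all_analysis.
From mathcomp Require Import ring lra measurable_realfun.

Import Order.TTheory GRing.Theory Num.Theory.
Import numFieldNormedType.Exports.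

(** Write H for the cumulative hazard, the integral of g / f from 1, so that
    1 - F = exp (- H) on [1, +oo[.  Continuity of H gives F (b_n) = 1 - 1/n,
    that is H (b_n) = ln n, and hence gamma_n (x) is the increment of H from
    b_n to b_n + a_n x.  Everything follows from an expansion of this increment.

    Put eps = C b^(-p), which is a(b) / b.  The affine substitution
    t = b + a v turns the increment into the integral over v from 0 to x of
    g (b + a v) (1 + eps v)^(p-1).  As g = 1 + alpha, the integrand minus
    1 + (p-1) eps v + alpha is
    (1 + alpha) ((1 + eps v)^(p-1) - 1 - (p-1) eps v) + alpha (p-1) eps v,
    which is o(|p-1| eps) uniformly in v because alpha tends to 0 and because of
    the derivative of the power at 1.  So gamma_n (x) - x is
    (p-1) eps x^2 / 2 plus the integral of alpha, up to o(|p-1| eps x^2)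
    ([hazard_increment_expansion]).  All the error is thus relative to the
    quadratic term alone, including in the degenerate cases p = 1 and x = 0, in
    which both vanish.  This is what makes the expansion survive a cancellation
    between the quadratic term and the integral of alpha.

    It remains to replace eps by 1 / (p ln n).  Averaging g -> 1 against
    t^(p-1) / C gives H(y) ~ y^p / (C p) ([hazard_equiv]), and at y = b_n this
    reads p eps ln n -> 1 ([eps_ln_cvg1]).

    For the law of the maximum, independence gives P (M_n <= a_n x + b_n) =
    (1 - c/n)^n with c = exp (- gamma_n (x)), and this differs from exp (- c) by
    at most c^2 / n ([expr_sub_expRN], [power_df_gumbel]).  Finally
    exp (- exp (- gamma_n)) is compared with exp (- exp (- x)) through the
    derivative of the Gumbel function at x, which is nonzero, so that the error
    is relative ([is_derive1_relative]). *)

Local Open Scope classical_set_scope.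
Local Open Scope ring_scope.

Local Notation mu := lebesgue_measure (only parsing).
Local Notation segment a b := ([set` `[Num.min a b, Num.max a b]%R] : set _)
  (only parsing).

(** * Affine change of variable *)

(** The scaled image of Lebesgue measure under v |-> s + a v gives every
    interval its own length, so it is Lebesgue measure by uniqueness. *)
Lemma ge0_integral_affine {R : realType} (s a : R) (D : set R)
    (f : R -> \bar R) :
  0 < a -> measurable D -> measurable_fun D f ->
  (forall t, D t -> 0 <= f t)%E ->
  (\int[mu]_(t in D) f t =
   a%:E * \int[mu]_(v in (fun v => (s + a * v)%R) @^-1` D) f (s + a * v)%R)%E.
Proof.
move=> a0 mD mf f0.
pose phi : measurableTypeR R -> measurableTypeR R := fun v => s + a * v.
have mphi : measurable_fun setT phi.
  by apply: measurable_funD => //; exact: measurable_funM.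
pose k : {nonneg R} := NngNum (ltW a0).
pose nu : {measure set (measurableTypeR R) -> \bar R} := mscale k mu.
pose phiM : {mfun measurableTypeR R >-> measurableTypeR R} :=
  HB.pack phi (isMeasurableFun.Build _ _ _ _ phi mphi).
have muE A : measurable A -> mu A = pushforward nu phiM A.
  move=> mA; apply: (@lebesgue_measure_unique R (pushforward nu phiM)) => //.
  move=> _ [[u v] _ <-].
  have pE : pushforward nu phiM `]u, v] =
      (a%:E * mu [set` `](u - s) / a, (v - s) / a]%R])%E.
    rewrite /pushforward /nu /mscale /=; congr (_ * mu _)%E.
    apply/seteqP; split => t /=; rewrite !in_itv /= /phi;
      by rewrite ltr_pdivrMr// ler_pdivlMr// ltrBlDl lerBrDl (mulrC t).
  apply: etrans (esym pE); rewrite /= !lebesgue_measure_itv /= !lte_fin.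
  rewrite ltr_pM2r ?invr_gt0// ltrD2r.
  case: ifPn => _; last by rewrite mule0.
  by rewrite -!EFinB -EFinM; congr (_%:E); field; rewrite gt_eqF.
rewrite (eq_measure_integral (pushforward nu phiM)); last first.
  by move=> A mA _; exact: muE.
rewrite ge0_integral_pushforward//; last by move=> y /[!inE]; exact: f0.
have mphiD : measurable (phi @^-1` D).
  by rewrite -[X in measurable X]setTI; exact: (mphi _ D mD).
rewrite ge0_integral_mscale//=.
- apply: (@measurable_comp _ _ _ _ _ _ D) => //; first by move=> _ [t Dt <-].
  exact: measurable_funTS.
- by move=> v; exact: f0.
Qed.

Lemma integral_affine {R : realType} (s a : R) (D : set R) (h : R -> R) :
  0 < a -> measurable D -> mu.-integrable D (EFin \o h) ->
  mu.-integrable ((fun v => s + a * v) @^-1` D)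
    (EFin \o (fun v => h (s + a * v))) /\
  \int[mu]_(t in D) h t =
  a * \int[mu]_(v in (fun v => s + a * v) @^-1` D) h (s + a * v).
Proof.
move=> a0 mD ih; pose phi := fun v : R => s + a * v.
have mphi : measurable_fun setT phi.
  by apply: measurable_funD => //; exact: measurable_funM.
have mphiD : measurable (phi @^-1` D).
  by rewrite -[X in measurable X]setTI; apply: mphi.
have mh := measurable_int _ ih.
have ihphi : mu.-integrable (phi @^-1` D) (EFin \o (h \o phi)).
  apply/integrableP; split.
    apply: (@measurable_comp _ _ _ _ _ _ D (EFin \o h) _ phi) => //.
      by move=> _ [t Dt <-].
    exact: measurable_funTS.
  have /integrableP[_] := ih.
  rewrite (@ge0_integral_affine _ s a D (fun t => `|(EFin \o h) t|%E))//; last first.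
    exact: measurableT_comp.
  rewrite /phi; move: (\int[mu]_(v in _) _)%E => [r _| |//]; first exact: ltry.
  by rewrite gt0_muley ?lte_fin.
split => //.
rewrite /Rintegral [in LHS]integralE.
rewrite !(@ge0_integral_affine _ s a D _ a0 mD)//; last 2 first.
- exact: measurable_funeneg.
- exact: measurable_funepos.
have intE : (\int[mu]_(v in phi @^-1` D) (h (phi v))%:E =
    \int[mu]_(v in phi @^-1` D) (EFin \o (h \o phi))^\+ v -
    \int[mu]_(v in phi @^-1` D) (EFin \o (h \o phi))^\- v)%E.
  by rewrite -integralE.
have fp : (\int[mu]_(v in phi @^-1` D) (EFin \o (h \o phi))^\+ v
    \is a fin_num)%E.
  exact/integrable_fin_num/integrable_funepos.
have fn : (\int[mu]_(v in phi @^-1` D) (EFin \o (h \o phi))^\- v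
    \is a fin_num)%E.
  exact/integrable_fin_num/integrable_funeneg.
rewrite [X in _ = a * fine X]intE.
apply: etrans (@fineM R a%:E _ _ _) => //; last by rewrite fin_numB fp.
congr fine; apply: esym; move: fp fn.
rewrite (funepos_comp (EFin \o h) phi) (funeneg_comp (EFin \o h) phi) => fp fn.
apply: muleBr => //.
by rewrite fin_num_adde_defl// fin_numN.
Qed.

(** * Oriented integrals *)

Lemma norm_segment0 {R : realType} (x v : R) :
  segment 0 x v -> `|v| <= `|x|.
Proof.
rewrite /=; case: (leP 0 x) => x0; rewrite in_itv /= => /andP[h1 h2].
  by rewrite !ger0_norm.
by rewrite (ltr0_norm x0) ler0_norm// lerN2.
Qed.

Lemma lebesgue_measure_segment {R : realType} (a b : R) :
  mu (segment a b) = `|b - a|%:E.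
Proof.
rewrite lebesgue_measure_itv /= lte_fin.
case: (ltgtP a b) => [ab|ba|->]; last by rewrite ltxx subrr normr0.
- by rewrite ab -EFinB gtr0_norm ?subr_gt0.
- by rewrite ba -EFinB ltr0_norm ?subr_lt0// opprB.
Qed.

Lemma lebesgue_measure_segment_lty {R : realType} (a b : R) :
  (mu (segment a b) < +oo)%E.
Proof. by rewrite lebesgue_measure_segment ltry. Qed.

(** The form used in computations: integration over the unordered segment,
    with a sign, so that linearity and bounds need no case analysis on the
    order of the endpoints. *)
Lemma oriented_integralE {R : realType} (a b : R) (h : R -> R) :
  oriented_integral a b h =
  (-1) ^+ (b < a)%R * \int[mu]_(v in segment a b) h v.
Proof.
rewrite /oriented_integral; case: leP => ab.
  by rewrite expr0 mul1r.
by rewrite expr1 mulN1r.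
Qed.

Lemma eq_oriented_integral {R : realType} (a b : R) (h k : R -> R) :
  (forall v, segment a b v -> h v = k v) ->
  oriented_integral a b h = oriented_integral a b k.
Proof.
move=> hk; rewrite !oriented_integralE; congr (_ * _).
by apply: eq_Rintegral => v /[!inE]; exact: hk.
Qed.

Lemma oriented_integralB {R : realType} (a b : R) (h k : R -> R) :
  mu.-integrable (segment a b) (EFin \o h) ->
  mu.-integrable (segment a b) (EFin \o k) ->
  oriented_integral a b (fun v => h v - k v) =
  oriented_integral a b h - oriented_integral a b k.
Proof. by move=> ih ik; rewrite !oriented_integralE RintegralB// mulrBr. Qed.

Lemma oriented_integralZ {R : realType} (a b k : R) (h : R -> R) :
  mu.-integrable (segment a b) (EFin \o h) ->
  oriented_integral a b (fun v => k * h v) = k * oriented_integral a b h.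
Proof. by move=> ih; rewrite !oriented_integralE RintegralZl// mulrCA. Qed.

Lemma integrable_rscale {R : realType} (D : set R) (k : R) (h : R -> R) :
  measurable D -> mu.-integrable D (EFin \o h) ->
  mu.-integrable D (EFin \o (fun v => k * h v)).
Proof.
move=> mD ih; have /(_ mD) := integrableZl _ k ih.
by apply: eq_integrable.
Qed.

Lemma integrable_rsub {R : realType} (D : set R) (h k : R -> R) :
  measurable D -> mu.-integrable D (EFin \o h) ->
  mu.-integrable D (EFin \o k) ->
  mu.-integrable D (EFin \o (fun v => h v - k v)).
Proof.
move=> mD ih ik; have /(_ mD) := integrableB _ ih ik.
by apply: eq_integrable.
Qed.

Lemma ler_norm_oriented_integral {R : realType} (a b : R) (h k : R -> R) :
  mu.-integrable (segment a b) (EFin \o h) ->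
  mu.-integrable (segment a b) (EFin \o k) ->
  (forall v, segment a b v -> `|h v| <= k v) ->
  `|oriented_integral a b h| <= `|oriented_integral a b k|.
Proof.
move=> ih ik hk.
rewrite !oriented_integralE !normrM !normrX !normrN1 !expr1n !mul1r.
apply: le_trans (le_normr_Rintegral _ _) _ => //.
rewrite [leRHS]ger0_norm; last first.
  by apply: Rintegral_ge0 => v /hk; exact: le_trans.
by apply: le_Rintegral => //; exact: integrable_norm.
Qed.

Lemma integrable_segment_cst {R : realType} (a b M : R) :
  mu.-integrable (segment a b) (EFin \o cst M).
Proof.
apply: measurable_bounded_integrable => //.
  exact: lebesgue_measure_segment_lty.
exact: bounded_cst.
Qed.

Lemma oriented_integral_cst {R : realType} (a b M : R) :
  oriented_integral a b (cst M) = M * (b - a).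
Proof.
rewrite oriented_integralE Rintegral_cst//.
have -> : fine (mu (segment a b)) = `|b - a| by rewrite lebesgue_measure_segment.
case: ltP => ab.
  by rewrite expr1 mulN1r ltr0_norm ?subr_lt0// mulrN opprK.
by rewrite expr0 mul1r ger0_norm ?subr_ge0.
Qed.

Lemma oriented_integral_FTC {R : realType} (a b : R) (h G : R -> R) :
  {within segment a b, continuous h} ->
  (forall t, segment a b t -> is_derive t 1 G (h t)) ->
  oriented_integral a b h = G b - G a.
Proof.
wlog ab : a b / a < b => [H hc hG|].
  case: (ltgtP a b) => [ab|ba|->]; first exact: H.
    have := H b a ba; rewrite /oriented_integral (ltW ba) leNgt ba /= minC maxC.
    by move=> -> //; rewrite opprB.
  by rewrite /oriented_integral lexx set_itv1 Rintegral_set1 subrr.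
rewrite (min_l (ltW ab)) (max_r (ltW ab)) => hc hG.
have Gc : {within `[a, b], continuous G}.
  apply: derivable_within_continuous => t tab.
  exact: (@ex_derive _ _ _ _ _ _ _ (hG t tab)).
rewrite /oriented_integral (ltW ab) /Rintegral (@continuous_FTC2 _ h G)//.
  have /(continuous_within_itvP _ ab)[_ Ga Gb] := Gc.
  split => // t /subset_itv_oo_cc tab.
  exact: (@ex_derive _ _ _ _ _ _ _ (hG t tab)).
move=> t /subset_itv_oo_cc tab; rewrite derive1E.
exact: (@derive_val _ _ _ _ _ _ _ (hG t tab)).
Qed.

(** Chasles' relation for the integral from 1. *)
Lemma oriented_integral_shift {R : realType} (a b : R) (h : R -> R) :
  (forall y, 1 <= y -> mu.-integrable `[1, y] (EFin \o h)) ->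
  1 <= a -> 1 <= b ->
  \int[mu]_(t in `[1, b]) h t - \int[mu]_(t in `[1, a]) h t =
  oriented_integral a b h.
Proof.
move=> ih; wlog ab : a b / a <= b => [H a1 b1|a1 b1].
  case: (leP a b) => ab; first exact: H.
  by rewrite -opprB (H b a) ?(ltW ab)// /oriented_integral (ltW ab) leNgt ab.
rewrite /oriented_integral ab -Rintegral_itv_obnd_cbnd; last first.
  apply: integrableS (ih b b1) => //; apply: subset_itvr.
  by rewrite bnd_simp.
by rewrite Rintegral_itvB//; exact: ih.
Qed.

(** Integrability is part of the conclusion because the rescaled integrand is
    later cut into pieces. *)
Lemma oriented_integral_affine {R : realType} (s a x : R) (h : R -> R) :
  0 < a -> mu.-integrable (segment s (s + a * x)) (EFin \o h) ->
  mu.-integrable (segment 0 x) (EFin \o (fun v => h (s + a * v))) /\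
  oriented_integral s (s + a * x) h =
  a * oriented_integral 0 x (fun v => h (s + a * v)).
Proof.
move=> a0 ih.
have pE : (fun v => s + a * v) @^-1` (segment s (s + a * x)) = segment 0 x.
  apply/seteqP; split => t /=; rewrite !in_itv /= !ge_min !le_max;
    by rewrite lerDl gerDl !lerD2l !ler_pM2l// pmulr_rge0// pmulr_rle0.
have [] := @integral_affine R s a _ _ a0 _ ih => //.
rewrite pE => ihs E; split => //.
rewrite !oriented_integralE E mulrCA; congr (_ * (_ ^+ _ * _)).
by rewrite gtrDl pmulr_rlt0.
Qed.

Lemma oriented_integral_linear {R : realType} (c x : R) :
  mu.-integrable (segment 0 x) (EFin \o (fun v => 1 + c * v)) /\
  oriented_integral 0 x (fun v => 1 + c * v) = x + c * x ^+ 2 / 2.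
Proof.
have cont : {within segment 0 x, continuous (fun v => 1 + c * v)}.
  apply: derivable_within_continuous => t _.
  by apply: derivableD => //; apply: derivableM.
split; first by apply: continuous_compact_integrable cont; exact: segment_compact.
rewrite (_ : x + _ = (x + c / 2 * x ^+ 2) - (0 + c / 2 * 0 ^+ 2)); last by field.
apply: (oriented_integral_FTC _ _ _ (fun v => v + c / 2 * v ^+ 2)) => // t _.
have did := is_derive_id t (1 : R).
have dG := is_deriveD did (is_deriveZ (c / 2) (is_deriveX 2 did)).
have -> : (fun v => v + c / 2 * v ^+ 2) = id + (c / 2) *: id ^+ 2 :> (R -> R).
  by apply/funext => v; rewrite /GRing.scale /= !fctE.
by apply: (is_derive_eq dG); rewrite /GRing.scale /=; field.
Qed.

(** * First-order expansions and elementary estimates *)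

Lemma is_derive1_first_order {R : realType} (G : R -> R) (x l : R) :
  is_derive x 1 G l ->
  forall e, 0 < e ->
    \forall h \near (0 : R), `|G (x + h) - G x - l * h| <= e * `|h|.
Proof.
move=> dG e e0.
have dvG := @ex_derive _ _ _ _ _ _ _ dG.
have : (fun h : R => h^-1 *: ((G \o shift x) (h *: (1 : R)) - G x)) @ 0^' --> l.
  by rewrite -(@derive_val _ _ _ _ _ _ _ dG); exact: dvG.
move=> /cvgrPdist_le/(_ e e0); rewrite near_withinE; apply: filterS => h hE.
have [->|h0] := eqVneq h 0.
  by rewrite addr0 subrr mulr0 subr0 normr0 mulr0.
have /= := hE h0; rewrite [h *: 1]mulr1 [h + x]addrC [_ *: _]mulrC => {}hE.
have -> : G (x + h) - G x - l * h = - (l - (G (x + h) - G x) / h) * h by field.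
by rewrite normrM normrN ler_wpM2r.
Qed.

(** A nonzero derivative makes the first-order error relative to the
    increment of G itself.  At an index with u n = x both sides vanish and the
    relative error is the quotient 0 / 0, which is 0. *)
Lemma is_derive1_relative {R : realType} (G : R -> R) (x l : R) (u : R^nat) :
  l != 0 -> is_derive x 1 G l -> u n @[n --> \oo] --> x ->
  exists2 e : R^nat, e n @[n --> \oo] --> (0 : R) &
    \forall n \near \oo, G (u n) - G x = l * (u n - x) * (1 + e n).
Proof.
move=> l0 dG ux.
have ux0 : (u n - x) @[n --> \oo] --> (0 : R).
  by rewrite -(subrr x); apply: cvgB => //; exact: cvg_cst.
have first_order e : 0 < e ->
    \forall n \near \oo, `|G (u n) - G x - l * (u n - x)| <= e * `|u n - x|.
  move=> e0; have := ux0 _ (@is_derive1_first_order _ G x l dG e e0).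
  rewrite near_simpl near_map; apply: filterS => n.
  by rewrite subrKC.
exists (fun n => (G (u n) - G x - l * (u n - x)) / (l * (u n - x))).
- apply/cvgr0Pnorm_le => e e0.
  have /first_order : 0 < e * `|l| by rewrite mulr_gt0 ?normr_gt0.
  apply: filterS => n.
  have [-> _|un] := eqVneq (u n - x) 0.
    by rewrite !mulr0 invr0 mulr0 !normr0 ltW.
  by rewrite normf_div normrM ler_pdivrMr ?mulrA// mulr_gt0// normr_gt0.
- have := first_order 1 ltr01; apply: filterS => n; rewrite mul1r.
  have [un|un _] := eqVneq (u n - x) 0.
    by rewrite un mulr0 mul0r subr0 normr0 normr_le0 => /eqP.
  by field; rewrite un l0.
Qed.

(** The factor |q| on the right makes the bound exact for q = 0, where the
    power is constant. *)
Lemma powR_first_order {R : realType} (q e : R) : 0 < e ->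
  \forall h \near (0 : R), `|(1 + h) `^ q - 1 - q * h| <= e * `|q| * `|h|.
Proof.
move=> e0; have [->|q0] := eqVneq q 0.
  by near=> h; rewrite powRr0 subrr mul0r subr0 !normr0 mulr0 mul0r.
have dpow : is_derive (1 : R) 1 (@powR R ^~ q) q.
  by apply: (is_derive_eq (is_derive1_powR q (@ltr01 R))); rewrite powR1 mulr1.
have eq0 : 0 < e * `|q| by rewrite mulr_gt0 ?normr_gt0.
by apply: filterS (is_derive1_first_order _ _ _ dpow _ eq0) => h; rewrite powR1.
Unshelve. all: by end_near. Qed.

Lemma powR_cvgy {R : realType} (p M : R) : 0 < p ->
  \forall y \near +oo, M <= y `^ p.
Proof.
move=> p0; near=> y.
have y0 : 0 < y by near: y; apply: nbhs_pinfty_gt; exact: num_real.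
apply: (@le_trans _ _ (`|M| `^ p^-1 `^ p)).
  by rewrite -powRrM mulVf ?gt_eqF// powRr1 ?normr_ge0// ler_norm.
apply: ge0_ler_powR; rewrite ?nnegrE; [exact: ltW|exact: powR_ge0|exact: ltW|].
by near: y; apply: nbhs_pinfty_ge; exact: num_real.
Unshelve. all: by end_near. Qed.

Lemma is_derive_gumbel {R : realType} (x : R) :
  is_derive x 1 (fun y => expR (- expR (- y)))
    (expR (- expR (- x)) * expR (- x)).
Proof.
by apply: is_derive_eq; rewrite /GRing.scale /=; ring.
Qed.

(** Both 1 - c/n and exp (- c/n) lie in [0, 1], and there n-th powers are
    n-Lipschitz; the two bases differ by at most (c/n)^2. *)
Lemma expr_sub_expRN {R : realType} (c : R) (n : nat) :
  (0 < n)%N -> 0 <= c <= n%:R ->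
  `|(1 - c / n%:R) ^+ n - expR (- c)| <= c ^+ 2 / n%:R.
Proof.
move=> n0 /andP[c0 cn]; have n0' : 0 < n%:R :> R by rewrite ltr0n.
set z := c / n%:R.
have z0 : 0 <= z by rewrite divr_ge0// ltW.
have z1 : z <= 1 by rewrite ler_pdivrMr// mul1r.
have -> : expR (- c) = expR (- z) ^+ n.
  by rewrite -expRM_natl; congr expR; rewrite /z; field; rewrite gt_eqF.
have -> : c ^+ 2 / n%:R = z ^+ 2 * n%:R by rewrite /z; field; rewrite gt_eqF.
have u01 : 0 <= 1 - z <= 1 by rewrite subr_ge0 z1 gerBl z0.
have w01 : 0 <= expR (- z) <= 1 by rewrite expR_ge0 expR_le1 oppr_le0.
have uw : `|1 - z - expR (- z)| <= z ^+ 2.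
  (* 1 - z <= exp (- z) <= 1 / (1 + z) <= 1 - z + z^2 *)
  have h1 := expR_ge1Dx (- z); have h2 := expR_ge1Dx z.
  have h3 : expR (- z) * (1 + z) <= 1.
    rewrite -[leRHS](expRxMexpNx_1 z) mulrC.
    by apply: ler_wpM2r => //; exact: expR_ge0.
  rewrite ler_norml; apply/andP; split; last by nra.
  have : 0 < 1 + z by lra.
  have := expR_gt0 (- z).
  nra.
rewrite subrXX normrM mulrC [z ^+ 2 * _]mulrC ler_pM//.
rewrite (le_trans (ler_norm_sum _ _ _))//.
rewrite (le_trans (ler_sum _ (G := fun=> 1) _))//; last first.
  by rewrite sumr_const card_ord.
move=> i _; rewrite normrM !normrX.
case/andP: u01 => a1 a2; case/andP: w01 => b1 b2.
by rewrite mulr_ile1 ?exprn_ge0// exprn_ile1// ger0_norm.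
Qed.

(** When the error is small relative to A alone, it is absorbed by the factor
    of A, and that of B can be taken to be 1.  If moreover |A| + |B| is bounded
    by a multiple of |A + B|, the error is also small relative to A + B. *)
Lemma equiv_to_sumI {R : realType} (u A B : R^nat) :
  (forall e, 0 < e ->
    \forall n \near \oo, `|u n - (A n + B n)| <= e * `|A n|) ->
  equiv_to_sum u A B.
Proof.
move=> uAB; split.
- exists (fun n => (u n - (A n + B n)) / A n), (fun=> 0); split.
  + apply/cvgr0Pnorm_le => e e0; apply: filterS (uAB e e0) => n.
    have [-> _|An] := eqVneq (A n) 0.
      by rewrite invr0 mulr0 normr0 ltW.
    by rewrite normf_div ler_pdivrMr// normr_gt0.
  + exact: cvg_cst.
  + have := uAB 1 ltr01; apply: filterS => n; rewrite mul1r.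
    have [->|An _] := eqVneq (A n) 0; last by field.
    rewrite normr0 normr_le0 add0r subr_eq0 => /eqP ->.
    by rewrite mulr0 addr0 add0r mul1r.
move=> K; exists (fun n => if `|A n| + `|B n| <= K * `|A n + B n|
   then (u n - (A n + B n)) / (A n + B n) else 0); split.
- apply/cvgr0Pnorm_le => e e0.
  have K0 : 0 < `|K| + 1 by rewrite ltr_pwDr.
  have /uAB : 0 < e / (`|K| + 1) by rewrite divr_gt0.
  apply: filterS => n un; case: ifPn => [AB|_]; last by rewrite normr0 ltW.
  have [->|ABn] := eqVneq (A n + B n) 0.
    by rewrite invr0 mulr0 normr0 ltW.
  rewrite normf_div ler_pdivrMr ?normr_gt0//; apply: le_trans un _.
  rewrite mulrAC ler_pdivrMr// -mulrA ler_wpM2l ?(ltW e0)//.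
  have KK : K * `|A n + B n| <= `|K| * `|A n + B n|.
    by rewrite ler_wpM2r// ler_norm.
  have := normr_ge0 (B n); have := normr_ge0 (A n + B n).
  rewrite mulrDr mulr1 [_ * `|K|]mulrC; lra.
- have := uAB 1 ltr01; apply: filterS => n + AB; rewrite AB mul1r.
  have [AB0|ABn _] := eqVneq (A n + B n) 0; last by field.
  move: AB; rewrite AB0 normr0 mulr0 => AB.
  have -> : `|A n| = 0.
    by apply/eqP; rewrite eq_le normr_ge0 andbT (le_trans _ AB)// lerDl.
  by rewrite normr_le0 subr0 mulr0 => /eqP.
Qed.

(** * The distribution of the maximum *)

Lemma probability_partial_max_le {d} {T : measurableType d} {R : realType}
    (P : probability T R) (X : nat -> {RV P >-> R}) (F : R -> R) (n : nat)
    (y : R) :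
  iid_with_df X F -> (0 < n)%N ->
  P [set w | partial_max X n w <= y] = (F y ^+ n)%:E.
Proof.
move=> [indep XF] n0.
have -> : [set w | partial_max X n w <= y] =
    \bigcap_(i in [set` iota 0 n]) (X i @^-1` `]-oo, y]).
  apply/seteqP; split => w /=.
    move=> /bigmax_leP[_ H] i /=; rewrite mem_iota /= add0n in_itv /= => ilt.
    exact: (H (Ordinal ilt)).
  move=> H; have Xy i : (i < n)%N -> X i w <= y.
    by move=> ilt; have := H i; rewrite /= mem_iota add0n in_itv /=; exact.
  by apply/bigmax_leP; split => [|i _]; exact: Xy.
rewrite (indep (iota 0 n) (fun=> `]-oo, y]%classic))//; last exact: iota_uniq.
rewrite (eq_bigr (fun=> (F y)%:E)); last by move=> i _; exact: XF.
rewrite prodEFin.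
by rewrite big_const_seq count_predT size_iota iter_mulr_1.
Qed.

(** * The cumulative hazard and the quantiles of F *)

Definition hazard {R : realType} (p C : R) (g : R -> R) (y : R) : R :=
  \int[mu]_(t in `[1, y]) (g t / aux_fun p C t).

Section quantiles.
Context {R : realType} {p C : R} {g : R -> R}.
Context {F : cumulativeBounded (0 : R) (1 : R)}.
Context (hF : weibull_like_df p C g F).

Lemma df_hazard (y : R) : 1 <= y -> F y = 1 - expR (- hazard p C g y).
Proof. by move=> /(proj2 hF) <-; rewrite subKr. Qed.

Lemma hazard1 : hazard p C g 1 = 0.
Proof. by rewrite /hazard set_itv1 Rintegral_set1. Qed.

Lemma df1 : F 1 = 0.
Proof. by rewrite df_hazard// hazard1 oppr0 expR0 subrr. Qed.

Lemma df_nondecreasing : {homo F : y z / y <= z}.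
Proof. exact: (cumulative_is_nondecreasing F). Qed.

Lemma df_right_continuous (b e : R) : 0 < e ->
  exists2 d, 0 < d & F (b + d) <= F b + e.
Proof.
move=> e0; have [d Fbd] := @nondecreasing_right_continuousP R b e F e0.
by exists d%:num.
Qed.

Lemma df_lt1 (y : R) : F y < 1.
Proof.
apply: le_lt_trans (_ : F (Num.max 1 y) < 1).
  by apply: df_nondecreasing; rewrite le_max lexx orbT.
by rewrite df_hazard ?le_max ?lexx// gtrBl expR_gt0.
Qed.

(** F vanishes at 1 and hence everywhere before it, so that quantiles of
    positive levels lie in the range governed by the hazard. *)
Lemma df_gt0_gt1 (y : R) : 0 < F y -> 1 < y.
Proof.
move=> F0; rewrite ltNge; apply/negP => /df_nondecreasing.
by rewrite df1 leNgt F0.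
Qed.

(** The level 1 - 1/n is attained at some c, by the intermediate value theorem
    applied to H; then F (b_n) <= F c by monotonicity, and the reverse
    inequality is right continuity at the infimum. *)
Lemma df_quantile (n : nat) : (1 < n)%N ->
  1 <= b_ F n /\ F (b_ F n) = 1 - n%:R^-1.
Proof.
move=> n1; have n0 : 0 < n%:R :> R by rewrite ltr0n ltnW.
set q : R := 1 - n%:R^-1.
have q0 : 0 < q by rewrite subr_gt0 invf_lt1// ltr1n.
have E1 y : q <= F y -> 1 <= y.
  by move=> /(lt_le_trans q0)/df_gt0_gt1/ltW.
have [Y Y1 qY] : exists2 Y, 1 <= Y & q <= F Y.
  have : \forall y \near +oo, q <= F y /\ 1 <= y.
    near=> y; split; near: y; last exact: nbhs_pinfty_ge.
    have /cvgrPdist_le/(_ n%:R^-1) := cumulativey F.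
    rewrite invr_gt0 => /(_ n0); apply: filterS => y.
    by rewrite ler_norml lerBlDr -lerBlDl => /andP[].
  by case/filter_ex => Y [? ?]; exists Y.
have [c c1 Fc] : exists2 c, 1 <= c & F c = q.
  have Hc := @parameterized_integral_continuous R 1 Y _ Y1 (hF.1 Y Y1).
  have [|c] := @IVT _ _ 1 Y (ln n%:R) Y1 Hc.
    rewrite /parameterized_integral -!/(hazard p C g _) hazard1.
    rewrite ge_min le_max ln_ge0 ?ler1n ?(ltnW n1)//=; apply/orP; right.
    rewrite -lerN2 -ler_expR expRN [leRHS]expRN lnK ?posrE//.
    by move: qY; rewrite df_hazard// /q expRN lerD2l lerN2.
  rewrite in_itv /= => /andP[c1 _].
  rewrite -[X in X = _]/(hazard p C g c) => cE.
  by exists c => //; rewrite df_hazard// cE expRN lnK.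
have lbE : has_lbound [set x | q <= F x] by exists 1 => y /= /E1.
have b1 : 1 <= b_ F n by apply: lb_le_inf => [|y /= /E1//]; exists Y.
split => //; apply/eqP; rewrite eq_le; apply/andP; split.
  rewrite -Fc; apply: df_nondecreasing; apply: ge_inf => //=.
  by rewrite Fc.
rewrite leNgt; apply/negP => Fbq.
have [d d0 Fbd] := df_right_continuous (b_ F n) ((q - F (b_ F n)) / 2)
  (divr_gt0 (etrans (subr_gt0 _ _) Fbq) (ltr0n _ 2)).
suff : b_ F n + d <= b_ F n by rewrite gerDl leNgt d0.
apply: lb_le_inf; first by exists Y.
move=> y /= qy; rewrite leNgt; apply/negP => /ltW/df_nondecreasing Fyd.
have : q <= F (b_ F n) + (q - F (b_ F n)) / 2.
  by apply: le_trans Fbd; apply: le_trans Fyd.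
move: (F (b_ F n)) Fbq => fb; lra.
Unshelve. all: by end_near. Qed.

Lemma hazard_quantile (n : nat) : (1 < n)%N -> hazard p C g (b_ F n) = ln n%:R.
Proof.
move=> n1; have [b1] := df_quantile n n1; rewrite df_hazard//.
move=> /addrI/oppr_inj E; have := congr1 (@ln R) E.
by rewrite expRK lnV ?posrE ?ltr0n ?(ltnW n1)// => /oppr_inj.
Qed.

(** No fixed M can exceed b_n for large n because F M < 1. *)
Lemma quantile_cvgy : b_ F n @[n --> \oo] --> +oo.
Proof.
apply/cvgryPge => M; near=> n.
have n1 : (1 < n)%N by near: n; exact: nbhs_infty_gt.
have [_ Fb] := df_quantile n n1.
rewrite leNgt; apply/negP => /ltW/df_nondecreasing.
rewrite Fb leNgt => /negP; apply.
rewrite ltrBrDr -ltrBrDl.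
suff : (1 - F M)^-1 < n%:R.
  by move=> h; rewrite invf_plt ?posrE ?subr_gt0 ?df_lt1// ltr0n ltnW.
by near: n; exact: nbhs_infty_gtr.
Unshelve. all: by end_near. Qed.

End quantiles.

(** * Growth of the cumulative hazard *)

Section hazard_asymptotics.
Context {R : realType} {p C : R} (hp : 0 < p) (hC : 0 < C).

Lemma inv_aux_fun (t : R) : 0 < t -> (aux_fun p C t)^-1 = C^-1 * t `^ (p - 1).
Proof. by move=> t0; rewrite /aux_fun invfM -powRN opprB. Qed.

Lemma segment_gt0 (a b t : R) : 0 < a -> 0 < b -> segment a b t -> 0 < t.
Proof.
move=> a0 b0 /=; rewrite in_itv /= => /andP[+ _]; apply: lt_le_trans.
by rewrite lt_min a0.
Qed.

Lemma inv_aux_fun_continuous (a b : R) : 0 < a -> 0 < b ->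
  {within segment a b, continuous (fun t => C^-1 * t `^ (p - 1))}.
Proof.
move=> a0 b0; apply: derivable_within_continuous.
move=> t /(segment_gt0 _ _ _ a0 b0) t0.
apply: derivableM => //; apply: derivable_powR.
by rewrite in_itv /= t0.
Qed.

Lemma integrable_inv_aux_fun (a b : R) : 0 < a -> 0 < b ->
  mu.-integrable (segment a b) (EFin \o (fun t => (aux_fun p C t)^-1)).
Proof.
move=> a0 b0.
apply: eq_integrable (_ : mu.-integrable _
  (EFin \o (fun t => C^-1 * t `^ (p - 1)))) => //.
  by move=> t /[!inE] /(segment_gt0 _ _ _ a0 b0) t0; rewrite /= inv_aux_fun.
apply: continuous_compact_integrable; first exact: segment_compact.
exact: inv_aux_fun_continuous.
Qed.

Lemma oriented_integral_inv_aux_fun (a b : R) : 0 < a -> 0 < b ->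
  oriented_integral a b (fun t => (aux_fun p C t)^-1) =
  (b `^ p - a `^ p) / (C * p).
Proof.
move=> a0 b0.
transitivity (oriented_integral a b (fun t => C^-1 * t `^ (p - 1))).
  apply: eq_oriented_integral => t /(segment_gt0 _ _ _ a0 b0).
  exact: inv_aux_fun.
have -> : (b `^ p - a `^ p) / (C * p) =
    (C * p)^-1 * b `^ p - (C * p)^-1 * a `^ p.
  by rewrite -mulrBr mulrC.
apply: (oriented_integral_FTC _ _ _ (fun t => (C * p)^-1 * t `^ p)).
- exact: inv_aux_fun_continuous.
- move=> t /(segment_gt0 _ _ _ a0 b0) t0.
  have := is_derive1_powR p t0 => dpow.
  have := is_deriveZ (C * p)^-1 dpow.
  move=> dG; apply: (is_derive_eq dG); rewrite /GRing.scale /=; field.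
  by rewrite !gt_eqF.
Qed.

Context {g : R -> R} (hg : g t @[t --> +oo] --> (1 : R)).
Context (gint : forall y, 1 <= y ->
  mu.-integrable `[1, y] (EFin \o (fun t => g t / aux_fun p C t))).

Lemma integrable_hazard_rate (a b : R) : 1 <= a -> 1 <= b ->
  mu.-integrable (segment a b) (EFin \o (fun t => g t / aux_fun p C t)).
Proof.
move=> a1 b1; apply: integrableS (gint (Num.max a b) _) => //.
- by apply: subset_itvr; rewrite bnd_simp le_min a1.
- by rewrite le_max a1.
Qed.

Lemma hazard_rate_near (e : R) : 0 < e ->
  exists2 T, 1 <= T & forall t, T <= t -> `|g t - 1| <= e.
Proof.
move=> e0; have [T [Tr gT]] : \forall t \near +oo, `|g t - 1| <= e.
  by move/cvgrPdist_le : hg => /(_ e e0); apply: filterS => t; rewrite distrC.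
exists (Num.max 1 (T + 1)) => [|t]; first by rewrite le_max lexx.
by rewrite ge_max => /andP[_ Tt]; apply: gT; rewrite (lt_le_trans _ Tt)// ltrDl.
Qed.

(** Beyond some T the rate g / f is within e/2 of 1 / f in relative terms, and
    1 / f integrates to a multiple of y^p - T^p; the part before T is a
    constant, which is negligible against y^p. *)
Lemma hazard_equiv (e : R) : 0 < e ->
  \forall y \near +oo, `|C * p * hazard p C g y - y `^ p| <= e * y `^ p.
Proof.
move=> e0; have e20 : 0 < e / 2 by rewrite divr_gt0.
have [T T1 gT] := hazard_rate_near _ e20.
pose M := `|C * p * hazard p C g T - T `^ p|.
near=> y.
have Ty : T <= y by near: y; apply: nbhs_pinfty_ge; exact: num_real.
have y1 := le_trans T1 Ty.
have T0 : 0 < T by exact: lt_le_trans T1.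
have y0 : 0 < y by exact: lt_le_trans y1.
have My : M <= e / 2 * y `^ p.
  by rewrite mulrC -ler_pdivrMr//; near: y; exact: powR_cvgy.
have shift := oriented_integral_shift T y _ gint T1 y1.
have irate := integrable_hazard_rate T y T1 y1.
have iinv := integrable_inv_aux_fun T y T0 y0.
have : `|hazard p C g y - hazard p C g T - (y `^ p - T `^ p) / (C * p)| <=
    e / 2 * ((y `^ p - T `^ p) / (C * p)).
  rewrite [X in `|X - _|]shift.
  rewrite -[X in `|_ - X|]oriented_integral_inv_aux_fun// -oriented_integralB//.
  have Cp0 : 0 < C * p by rewrite mulr_gt0.
  apply: le_trans (ler_norm_oriented_integral _ _ _
    (fun t => e / 2 * (aux_fun p C t)^-1) _ _ _) _.
  - exact: integrable_rsub.
  - exact: integrable_rscale.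
  - move=> t; rewrite /= in_itv /= min_l// max_r// => /andP[Tt ty].
    have t0 : 0 < aux_fun p C t.
      by rewrite mulr_gt0// powR_gt0// (lt_le_trans T0).
    rewrite -[X in _ - X]mul1r -mulrBl normrM [X in _ * X]gtr0_norm ?invr_gt0//.
    by rewrite ler_pM2r ?invr_gt0// gT.
  have -> : oriented_integral T y (fun t => e / 2 * (aux_fun p C t)^-1) =
      e / 2 * ((y `^ p - T `^ p) / (C * p)).
    by rewrite oriented_integralZ// oriented_integral_inv_aux_fun.
  rewrite ger0_norm// mulr_ge0 ?(ltW e20)// divr_ge0 ?(ltW Cp0)// subr_ge0.
  by apply: ge0_ler_powR => //; rewrite ?nnegrE ltW.
set Hy := hazard p C g y; set HT := hazard p C g T => est.
have Cp0 : 0 < C * p by rewrite mulr_gt0.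
have -> : C * p * Hy - y `^ p =
    C * p * (Hy - HT - (y `^ p - T `^ p) / (C * p)) +
    (C * p * HT - T `^ p).
  by field; rewrite !gt_eqF.
apply: le_trans (ler_normD _ _) _; rewrite normrM (gtr0_norm Cp0).
have : C * p * `|Hy - HT - (y `^ p - T `^ p) / (C * p)| <=
    e / 2 * (y `^ p - T `^ p).
  rewrite -ler_pdivlMl//; apply: le_trans est _.
  by rewrite le_eqVlt; apply/orP; left; apply/eqP; field; rewrite !gt_eqF.
have : 0 <= e / 2 * T `^ p by rewrite mulr_ge0 ?powR_ge0// ltW.
rewrite -/M -/HT; move: My; lra.
Unshelve. all: by end_near. Qed.

End hazard_asymptotics.

(** * Increments of the hazard over the window b + a x *)

Section hazard_increment.
Context {R : realType} {p C : R} (hp : 0 < p) (hC : 0 < C).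
Context {g : R -> R} (hg : g t @[t --> +oo] --> (1 : R)).
Context (gint : forall y, 1 <= y ->
  mu.-integrable `[1, y] (EFin \o (fun t => g t / aux_fun p C t))).

Local Notation a := (aux_fun p C).
Local Notation eps b := (C * b `^ (- p)).

Lemma aux_fun_gt0 (b : R) : 0 < b -> 0 < a b.
Proof. by move=> b0; rewrite mulr_gt0// powR_gt0. Qed.

(** This is why eps is the natural small parameter: b + a v = b (1 + eps v). *)
Lemma aux_funE (b : R) : 0 < b -> a b = b * eps b.
Proof.
move=> b0; rewrite /aux_fun powRD ?(gt_eqF b0) ?implybT// powRr1 ?(ltW b0)//.
by rewrite mulrCA.
Qed.

Lemma aux_fun_ratio (b v : R) : 0 < b -> 0 < 1 + eps b * v ->
  a b / a (b + a b * v) = (1 + eps b * v) `^ (p - 1).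
Proof.
move=> b0 v0; rewrite {2}aux_funE//.
have -> : b + b * eps b * v = b * (1 + eps b * v) by ring.
rewrite /aux_fun powRM ?(ltW b0) ?(ltW v0)//.
rewrite -(opprB 1 p) (powRN _ (1 - p)); field.
by rewrite !gt_eqF// powR_gt0.
Qed.

(** Measurability is assumed of g / f, and f is measurable and nonzero. *)
Lemma measurable_hazard_factor (y : R) : 1 <= y -> measurable_fun `[1, y] g.
Proof.
move=> y1.
apply: (eq_measurable_fun (fun t => g t / a t * a t)).
  move=> t; rewrite inE /= in_itv /= => /andP[t1 _].
  by rewrite divfK// gt_eqF// aux_fun_gt0// (lt_le_trans ltr01).
apply: measurable_funM.
  apply/measurable_EFinP; exact: (measurable_int mu (gint y y1)).
by apply: measurable_funM => //; apply: measurable_funTS; exact: measurable_powR.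
Qed.

Lemma integrable_hazard_defect (b c T : R) :
  1 <= T -> T <= b -> T <= c -> (forall t, T <= t -> `|g t - 1| <= 1) ->
  mu.-integrable (segment b c) (EFin \o (fun t => g t - 1)).
Proof.
move=> T1 Tb Tc gT.
have b1 := le_trans T1 Tb; have c1 := le_trans T1 Tc.
apply: measurable_bounded_integrable => //.
- exact: lebesgue_measure_segment_lty.
- apply: measurable_funB => //.
  apply: measurable_funS (measurable_hazard_factor (Num.max b c) _) => //.
    by apply: subset_itvr; rewrite bnd_simp le_min b1.
  by rewrite le_max b1.
- exists 1; split; first exact: num_real.
  move=> M M1 t /=; rewrite in_itv /= => /andP[+ _].
  rewrite ge_min => bct; apply: le_trans (ltW M1); apply: gT.
  by case/orP: bct; exact: le_trans.
Qed.

Lemma hazard_increment (b x : R) : 1 <= b -> 1 <= b + a b * x ->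
  (forall v, segment 0 x v -> 0 < 1 + eps b * v) ->
  mu.-integrable (segment 0 x)
    (EFin \o (fun v => g (b + a b * v) * (1 + eps b * v) `^ (p - 1))) /\
  hazard p C g (b + a b * x) - hazard p C g b =
  oriented_integral 0 x (fun v => g (b + a b * v) * (1 + eps b * v) `^ (p - 1)).
Proof.
move=> b1 bx1 v0; have b0 : 0 < b by exact: lt_le_trans b1.
have ab0 := aux_fun_gt0 b b0.
have [ih hE] := oriented_integral_affine b (a b) x _ ab0
  (integrable_hazard_rate gint b (b + a b * x) b1 bx1).
have wE v : segment 0 x v ->
    a b * (g (b + a b * v) / a (b + a b * v)) =
    g (b + a b * v) * (1 + eps b * v) `^ (p - 1).
  by move=> /v0 v1; rewrite -aux_fun_ratio// mulrCA.
split.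
  apply: eq_integrable (integrable_rscale _ (a b) _ _ ih) => //.
  by move=> v /[!inE] /wE /= ->.
rewrite oriented_integral_shift// hE -oriented_integralZ//.
exact: eq_oriented_integral.
Qed.

Lemma eps_cvg0 (e : R) : 0 < e -> \forall b \near +oo, 0 < eps b <= e.
Proof.
move=> e0; near=> b.
have b0 : 0 < b by near: b; apply: nbhs_pinfty_gt; exact: num_real.
rewrite mulr_gt0 ?powR_gt0//= powRN ler_pdivrMr ?powR_gt0// mulrC -ler_pdivrMr//.
by near: b; exact: powR_cvgy.
Unshelve. all: by end_near. Qed.

(** As eps tends to 0, the window between b and b + a x stays beyond b / 2,
    hence beyond any given threshold. *)
Lemma near_segment (x T : R) : 1 <= T -> \forall b \near +oo,
  [/\ T <= b, T <= b + a b * x &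
   forall v, segment 0 x v -> T <= b + a b * v /\ 0 < 1 + eps b * v].
Proof.
move=> T1; have d0 : 0 < (2 * (`|x| + 1))^-1.
  by rewrite invr_gt0 mulr_gt0// ltr_pwDr.
near=> b.
have /andP[e0 ed] : 0 < eps b <= (2 * (`|x| + 1))^-1.
  by near: b; exact: eps_cvg0.
have Tb : 2 * T <= b by near: b; apply: nbhs_pinfty_ge; exact: num_real.
have b0 : 0 < b by rewrite (lt_le_trans _ Tb)// mulr_gt0// (lt_le_trans _ T1).
have ex : eps b * `|x| <= 2^-1.
  have h : (2 * (`|x| + 1))^-1 * (2 * (`|x| + 1)) = 1.
    by rewrite mulVf// gt_eqF// mulr_gt0// ltr_pwDr.
  have : eps b * (2 * (`|x| + 1)) <= 1.
    by rewrite -[leRHS]h ler_wpM2r// mulr_ge0// ltW// ltr_pwDr.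
  move: e0; lra.
have seg v : `|v| <= `|x| -> T <= b + a b * v /\ 0 < 1 + eps b * v.
  move=> vx; have : `|eps b * v| <= 2^-1.
    by rewrite normrM (gtr0_norm e0) (le_trans _ ex)// ler_pM2l.
  rewrite ler_norml => /andP[h _]; split; last by move: h; lra.
  rewrite aux_funE// -mulrA -[X in X + _]mulr1 -mulrDr.
  apply: le_trans (_ : b * 2^-1 <= _); first by rewrite ler_pdivlMr// mulrC.
  by rewrite ler_pM2l//; move: h; lra.
split.
- by apply: le_trans Tb; move: T1; lra.
- by have [] := seg x (lexx _).
- move=> v vx; apply: seg; exact: norm_segment0.
Unshelve. all: by end_near. Qed.

(** On the segment the integrand differs from 1 + (p-1) eps v + alpha by at most
    e |p-1| eps |x|, and integrating this constant gives the stated bound.  The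
    factor |p-1| survives because both error terms come from the variation of
    (1 + eps v)^(p-1) with v. *)
Lemma hazard_increment_expansion (x e : R) : 0 < e ->
  \forall b \near +oo,
    `|hazard p C g (b + a b * x) - hazard p C g b
      - (x + (p - 1) * eps b * x ^+ 2 / 2)
      - oriented_integral 0 x (fun v => g (b + a b * v) - 1)| <=
    e * (`|p - 1| * eps b * x ^+ 2).
Proof.
(* with |alpha| <= e1 <= 1 the two error terms are at most 2 e1 N and e1 N,
   where N = |p-1| |eps v| *)
move=> e0; pose e1 := Num.min 1 (e / 3).
have e10 : 0 < e1 by rewrite lt_min ltr01 divr_gt0.
have e11 : e1 <= 1 by rewrite ge_min lexx.
have e13 : 3 * e1 <= e by rewrite mulrC -ler_pdivlMr// ge_min lexx orbT.
have [T T1 gT] := hazard_rate_near hg e1 e10.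
have [d d0 hd] : exists2 d, 0 < d & forall h, `|h| <= d ->
    `|(1 + h) `^ (p - 1) - 1 - (p - 1) * h| <= e1 * `|p - 1| * `|h|.
  have [d /= d0 hd] := powR_first_order (p - 1) e1 e10.
  exists (d / 2) => [|h hd2]; first by rewrite divr_gt0.
  apply: hd; rewrite /= sub0r normrN (le_lt_trans hd2)//.
  by rewrite ltr_pdivrMr// ltr_pMr// ltr1n.
near=> b.
have [Tb Tbx seg] : [/\ T <= b, T <= b + a b * x &
   forall v, segment 0 x v -> T <= b + a b * v /\ 0 < 1 + eps b * v].
  by near: b; exact: near_segment.
have b1 := le_trans T1 Tb; have bx1 := le_trans T1 Tbx.
have b0 : 0 < b by exact: lt_le_trans b1.
have /andP[ep0 epd] : 0 < eps b <= d / (`|x| + 1).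
  by near: b; apply: eps_cvg0; rewrite divr_gt0// ltr_pwDr.
have [ik kE] := hazard_increment b x b1 bx1 (fun v vx => (seg v vx).2).
have [il lE] := oriented_integral_linear ((p - 1) * eps b) x.
have idef : mu.-integrable (segment b (b + a b * x))
    (EFin \o (fun t => g t - 1)).
  apply: (integrable_hazard_defect _ _ T) => // t Tt.
  by apply: le_trans (gT t Tt) _.
have [ij _] := oriented_integral_affine b (a b) x _ (aux_fun_gt0 b b0) idef.
rewrite kE -lE -oriented_integralB// -oriented_integralB//; last first.
  exact: integrable_rsub.
pose M := e * (`|p - 1| * eps b * `|x|).
have -> : e * (`|p - 1| * eps b * x ^+ 2) = `|oriented_integral 0 x (cst M)|.
  rewrite oriented_integral_cst subr0 /M normrM ger0_norm.
    by rewrite -(real_normK (num_real x)) expr2; ring.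
  by rewrite !mulr_ge0 ?powR_ge0// ltW.
apply: ler_norm_oriented_integral.
- by apply: integrable_rsub => //; exact: integrable_rsub.
- exact: integrable_segment_cst.
move=> v vx; have [Tv _] := seg v vx.
have nvx := norm_segment0 x v vx.
set al := g (b + a b * v) - 1.
have alE : g (b + a b * v) = 1 + al by rewrite /al; ring.
have ale : `|al| <= e1 by exact: gT.
set h := eps b * v.
have hx : `|h| <= eps b * `|x| by rewrite normrM (gtr0_norm ep0) ler_pM2l.
have hle : `|h| <= d.
  apply: le_trans hx _; apply: le_trans (_ : eps b * (`|x| + 1) <= _).
    by rewrite ler_pM2l// lerDl.
  by rewrite -ler_pdivlMr// ltr_pwDr.
have := hd h hle; set w := (1 + h) `^ (p - 1); rewrite -(mulrA e1) => hw.
rewrite alE /cst -[(p - 1) * _ * v]mulrA -/h.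
have -> : (1 + al) * w - (1 + (p - 1) * h) - al =
    (1 + al) * (w - 1 - (p - 1) * h) + al * ((p - 1) * h) by ring.
apply: le_trans (ler_normD _ _) _.
rewrite (normrM (1 + al)) (normrM al) (normrM (p - 1)).
have al2 : `|1 + al| <= 2.
  by apply: le_trans (ler_normD _ _) _; rewrite normr1; move: ale e11; lra.
set N := `|p - 1| * `|h|.
have N0 : 0 <= N by rewrite mulr_ge0.
apply: le_trans (_ : 2 * (e1 * N) + e1 * N <= _).
  apply: lerD; last by rewrite ler_wpM2r.
  exact: ler_pM.
apply: le_trans (_ : e * N <= _).
  have : 3 * e1 * N <= e * N by rewrite ler_wpM2r.
  lra.
by rewrite /M ler_pM2l// -mulrA ler_wpM2l.
Unshelve. all: by end_near. Qed.

Lemma defect_integral_cvg0 (x e : R) : 0 < e -> \forall b \near +oo,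
  `|oriented_integral 0 x (fun v => g (b + a b * v) - 1)| <= e.
Proof.
move=> e0; pose e1 := Num.min 1 (e / (`|x| + 1)).
have e10 : 0 < e1 by rewrite lt_min ltr01 divr_gt0// ltr_pwDr.
have e11 : e1 <= 1 by rewrite ge_min lexx.
have [T T1 gT] := hazard_rate_near hg e1 e10.
near=> b.
have [Tb Tbx seg] : [/\ T <= b, T <= b + a b * x &
   forall v, segment 0 x v -> T <= b + a b * v /\ 0 < 1 + eps b * v].
  by near: b; exact: near_segment.
have ab0 : 0 < a b by rewrite aux_fun_gt0// (lt_le_trans ltr01)// (le_trans T1).
have idef : mu.-integrable (segment b (b + a b * x))
    (EFin \o (fun t => g t - 1)).
  apply: (integrable_hazard_defect _ _ T) => // t Tt.
  by apply: le_trans (gT t Tt) _.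
have [ij _] := oriented_integral_affine b (a b) x _ ab0 idef.
apply: le_trans (ler_norm_oriented_integral _ _ _ (cst e1) ij _ _) _.
- exact: integrable_segment_cst.
- by move=> v /seg[Tv _]; exact: gT.
rewrite oriented_integral_cst subr0 normrM (gtr0_norm e10).
apply: le_trans (_ : e1 * (`|x| + 1) <= _); first by rewrite ler_pM2l// lerDl.
by rewrite -ler_pdivlMr ?ltr_pwDr// ge_min lexx orbT.
Unshelve. all: by end_near. Qed.

End hazard_increment.

(** * Expansion of gamma *)

Section gamma_expansion.
Context {R : realType} {p C : R} (hp : 0 < p) (hC : 0 < C).
Context {g : R -> R} (hg : g t @[t --> +oo] --> (1 : R)).
Context {F : cumulativeBounded (0 : R) (1 : R)}.
Context (hF : weibull_like_df p C g F).

Local Notation eps b := (C * b `^ (- p)).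

Lemma near_quantile (Q : R -> Prop) :
  (\forall b \near +oo, Q b) -> \forall n \near \oo, Q (b_ F n).
Proof. exact: (quantile_cvgy hF). Qed.

Lemma near_ln (M : R) : \forall n \near \oo, M <= ln (n%:R : R).
Proof.
near=> n; have n0 : expR M <= n%:R :> R by near: n; exact: nbhs_infty_ger.
by rewrite -ler_expR lnK// posrE (lt_le_trans _ n0)// expR_gt0.
Unshelve. all: by end_near. Qed.

(** This is the hazard asymptotics read at b_n, where H takes the value ln n. *)
Lemma eps_ln_cvg1 (e : R) : 0 < e ->
  \forall n \near \oo, `|p * eps (b_ F n) * ln n%:R - 1| <= e.
Proof.
move=> e0; near=> n.
have n1 : (1 < n)%N by near: n; exact: nbhs_infty_gt.
have [b1 _] := df_quantile hF n n1.
have b0 : 0 < b_ F n `^ p by rewrite powR_gt0// (lt_le_trans ltr01).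
have : `|C * p * hazard p C g (b_ F n) - b_ F n `^ p| <= e * b_ F n `^ p.
  near: n; apply: (near_quantile (fun b =>
    `|C * p * hazard p C g b - b `^ p| <= e * b `^ p)).
  exact: (hazard_equiv hp hC hg hF.1).
rewrite (hazard_quantile hF)// -ler_pdivrMr// => h.
apply: le_trans h; rewrite -[X in _ / X]gtr0_norm// -normf_div.
rewrite le_eqVlt; apply/orP; left; apply/eqP; congr (`|_|).
by rewrite powRN; field; rewrite gt_eqF.
Unshelve. all: by end_near. Qed.

Lemma gammaE (n : nat) (x : R) : (1 < n)%N -> 1 <= b_ F n + a_ p C F n * x ->
  gamma p C F n x =
  hazard p C g (b_ F n + a_ p C F n * x) - hazard p C g (b_ F n).
Proof.
move=> n1 bx1; have [b1 _] := df_quantile hF n n1.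
rewrite /gamma !(df_hazard hF)// !subKr -expRB expRK; ring.
Qed.

Lemma near_rescaled_ge1 (x : R) :
  \forall n \near \oo, 1 <= b_ F n + a_ p C F n * x.
Proof.
apply: (near_quantile (fun b => 1 <= b + aux_fun p C b * x)).
by apply: filterS (near_segment hp hC x 1 (lexx 1)) => b [].
Qed.

(** With rho = p eps ln n, the term (p-1) eps x^2 / 2 is rho times the quadratic
    term, and rho tends to 1. *)
Lemma gamma_expansion (x e : R) : 0 < e -> \forall n \near \oo,
  `|gamma p C F n x - x - (quadratic_term p x n + alpha_term p C g F x n)| <=
  e * `|quadratic_term p x n|.
Proof.
move=> e0; have e10 : 0 < e / 8 by rewrite divr_gt0.
have e20 : 0 < Num.min 1 (e / 2) by rewrite lt_min ltr01 divr_gt0.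
near=> n.
have n1 : (1 < n)%N by near: n; exact: nbhs_infty_gt.
have [b1 _] := df_quantile hF n n1.
have bx1 : 1 <= b_ F n + a_ p C F n * x by near: n; exact: near_rescaled_ge1.
rewrite gammaE//.
have ln0 : 0 < ln (n%:R : R) by rewrite ln_gt0// ltr1n.
have : `|p * eps (b_ F n) * ln n%:R - 1| <= Num.min 1 (e / 2).
  by near: n; exact: eps_ln_cvg1.
rewrite le_min => /andP[].
have : `|hazard p C g (b_ F n + a_ p C F n * x) - hazard p C g (b_ F n)
      - (x + (p - 1) * eps (b_ F n) * x ^+ 2 / 2) - alpha_term p C g F x n| <=
    e / 8 * (`|p - 1| * eps (b_ F n) * x ^+ 2).
  near: n; apply: (near_quantile (fun b =>
    `|hazard p C g (b + aux_fun p C b * x) - hazard p C g b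
      - (x + (p - 1) * eps b * x ^+ 2 / 2)
      - oriented_integral 0 x (fun v => g (b + aux_fun p C b * v) - 1)| <=
    e / 8 * (`|p - 1| * eps b * x ^+ 2))).
  exact: (hazard_increment_expansion hp hC hg hF.1 x _ e10).
set G := hazard _ _ _ _ - _; set B := alpha_term _ _ _ _ _ _.
set A := quadratic_term p x n; set rho := p * eps _ * _.
have qA : (p - 1) * eps (b_ F n) * x ^+ 2 = 2 * (A * rho).
  by rewrite /A /rho /quadratic_term; field; rewrite !gt_eqF.
have eps0 : 0 <= eps (b_ F n) by rewrite mulr_ge0 ?powR_ge0// ltW.
have -> : `|p - 1| * eps (b_ F n) * x ^+ 2 = 2 * (`|A| * `|rho|).
  rewrite -normrM -[2 in RHS](normr_nat R 2) -normrM -qA.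
  rewrite (normrM _ (x ^+ 2)) (normrM (p - 1)).
  by rewrite (ger0_norm eps0) (ger0_norm (sqr_ge0 x)).
rewrite qA; clearbody rho A B G => est rho1 rho2.
have rho_le2 : `|rho| <= 2.
  have -> : rho = (rho - 1) + 1 by ring.
  by apply: le_trans (ler_normD _ _) _; rewrite normr1; lra.
have -> : G - x - (A + B) =
  (G - (x + 2 * (A * rho) / 2) - B) + A * (rho - 1) by field.
apply: le_trans (ler_normD _ _) _; rewrite normrM.
have h1 : `|A| * `|rho| <= `|A| * 2 by rewrite ler_wpM2l.
have h2 : `|A| * `|rho - 1| <= `|A| * (e / 2) by rewrite ler_wpM2l.
have h3 : e * (`|A| * `|rho|) <= e * (`|A| * 2) by rewrite ler_pM2l.
move: est; lra.
Unshelve. all: by end_near. Qed.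

Lemma gamma_cvg (x : R) : gamma p C F n x @[n --> \oo] --> x.
Proof.
apply/cvgrPdist_le => e e0; have e40 : 0 < e / 4 by rewrite divr_gt0.
near=> n; rewrite distrC.
have : `|gamma p C F n x - x -
       (quadratic_term p x n + alpha_term p C g F x n)| <=
    1 * `|quadratic_term p x n| by near: n; exact: gamma_expansion.
rewrite mul1r; have hB : `|alpha_term p C g F x n| <= e / 4.
  near: n; apply: (near_quantile (fun b =>
    `|oriented_integral 0 x (fun v => g (b + aux_fun p C b * v) - 1)| <=
    e / 4)).
  exact: (defect_integral_cvg0 hp hC hg hF.1 x _ e40).
have hA : `|quadratic_term p x n| <= e / 4.
  have ln1 : 1 <= ln (n%:R : R) by near: n; exact: near_ln.
  have : `|(p - 1) * x ^+ 2 / (2 * p)| / (e / 4) <= ln (n%:R : R).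
    by near: n; exact: near_ln.
  have ln0 : 0 < ln (n%:R : R) by exact: lt_le_trans ln1.
  rewrite ler_pdivrMr// [leRHS]mulrC -ler_pdivrMr// => h; apply: le_trans h.
  rewrite -[X in _ / X]gtr0_norm// -normf_div /quadratic_term.
  rewrite le_eqVlt; apply/orP; left; apply/eqP; congr (`|_|).
  by field; rewrite !gt_eqF.
move: hA hB; set A := quadratic_term _ _ _; set B := alpha_term _ _ _ _ _ _.
set G := gamma _ _ _ _ _; clearbody A B G => hA hB h.
have -> : G - x = (G - x - (A + B)) + (A + B) by ring.
apply: le_trans (ler_normD _ _) _; have := ler_normD A B; lra.
Unshelve. all: by end_near. Qed.

(** As gamma_n (x) tends to x, c = exp (- gamma_n (x)) is eventually below
    exp (1 - x), which makes the bound c^2 / n uniform in n. *)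
Lemma power_df_gumbel (x : R) : exists K : R, \forall n \near \oo,
  `|F (a_ p C F n * x + b_ F n) ^+ n - expR (- expR (- gamma p C F n x))| <=
  K / n%:R.
Proof.
exists (expR (1 - x) ^+ 2); near=> n.
have n1 : (1 < n)%N by near: n; exact: nbhs_infty_gt.
have [b1 _] := df_quantile hF n n1.
have bx1 : 1 <= b_ F n + a_ p C F n * x by near: n; exact: near_rescaled_ge1.
have gE := gammaE n x n1 bx1.
have n0 : 0 < n%:R :> R by rewrite ltr0n ltnW.
set c := expR (- gamma p C F n x).
have Fc : F (a_ p C F n * x + b_ F n) = 1 - c / n%:R.
  rewrite addrC (df_hazard hF)// /c gE opprB expRB (hazard_quantile hF)//.
  rewrite lnK ?posrE// expRN; congr (1 - _); field.
  by rewrite !gt_eqF// expR_gt0.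
have c0 : 0 <= c by exact: expR_ge0.
have cn : c <= n%:R.
  have : 0 <= F (a_ p C F n * x + b_ F n).
    have := @df_nondecreasing _ F _ _ bx1; rewrite (df1 hF) addrC; exact.
  by rewrite Fc subr_ge0 ler_pdivrMr// mul1r.
rewrite Fc; apply: le_trans (expr_sub_expRN _ _ (ltnW n1) _) _.
  by rewrite c0.
rewrite ler_pM2r ?invr_gt0// lerXn2r ?nnegrE ?expR_ge0// ler_expR.
have : `|x - gamma p C F n x| <= 1.
  by near: n; move/cvgrPdist_le : (gamma_cvg x) => /(_ 1 ltr01).
rewrite ler_norml => /andP[]; lra.
Unshelve. all: by end_near. Qed.

End gamma_expansion.

(** * The expansion of the law of the maximum *)

Theorem proposition2 (R : realType) (p C : R) (hp : 0 < p) (hC : 0 < C)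
    (g : R -> R) (hg : g t @[t --> +oo] --> (1 : R))
    (F : cumulativeBounded (0 : R) (1 : R))
    (hFac : lebesgue_stieltjes_measure F `<< lebesgue_measure)
    (hF : weibull_like_df p C g F)
    (d : measure_display) (T : measurableType d) (P : probability T R)
    (X : nat -> {RV P >-> R}) (hX : iid_with_df X F) (x : R) :
  (exists e r : R^nat,
    [/\ e n @[n --> \oo] --> (0 : R),
        r =O_\oo (fun n => n%:R^-1 : R) &
        \forall n \near \oo,
          fine (P [set w | partial_max X n w <= a_ p C F n * x + b_ F n])
            - expR (- expR (- x)) =
          expR (- expR (- x)) * expR (- x) * (gamma p C F n x - x) * (1 + e n)
            + r n]) /\
  equiv_to_sum (fun n => gamma p C F n x - x)
    (quadratic_term p x) (alpha_term p C g F x).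
Proof.
split; last first.
  by apply: equiv_to_sumI => e e0; exact: gamma_expansion.
pose G := fun y : R => expR (- expR (- y)).
have l0 : G x * expR (- x) != 0 by rewrite gt_eqF// mulr_gt0// expR_gt0.
have [e e0 eG] := is_derive1_relative G x _ _ l0 (is_derive_gumbel x)
  (gamma_cvg hp hC hg hF x).
exists e, (fun n =>
  fine (P [set w | partial_max X n w <= a_ p C F n * x + b_ F n])
    - G (gamma p C F n x)); split => //.
  have [K hK] := power_df_gumbel hp hC hg hF x.
  apply/eqOP; near=> k; near=> n.
  have n0 : (0 < n)%N by near: n; exact: nbhs_infty_gt.
  rewrite (probability_partial_max_le _ _ _ _ _ hX n0) /=.
  have hKn :
      `|F (a_ p C F n * x + b_ F n) ^+ n - G (gamma p C F n x)| <= K / n%:R.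
    by near: n; exact: hK.
  apply: le_trans hKn _.
  rewrite [leRHS](_ : _ = k / n%:R); last by rewrite ger0_norm.
  by rewrite ler_wpM2r.
apply: filterS eG => n /= eGn.
rewrite -/(G x) -eGn; ring.
Unshelve. all: by end_near. Qed.
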